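(* Let $\mathcal{F}$ be a family of languages such that for every infinite language $L \in \mathcal{F}$ there exists a word $w \neq \lambda$ with $\{w^{n} \mid n \geq 1\} \subseteq \mathrm{Sub}(L)$. Then $\mathcal{F}$ avoids almost periodicity, i.e. every almost periodic language in $\mathcal{F}$ is regular.
   Context: A language is a set $L \subseteq V^{*}$ of finite words over some finite alphabet $V$; $\lambda$ denotes the empty word and $|z|$ the length of $z$. For words $z, w$, write $z < w$ if $z$ is a (contiguous, not necessarily proper) factor of $w$. In this paper ''subword'' means factor. For a language $L$, $\mathrm{Sub}(L)$ is the set of all factors of words of $L$. A language $L \subseteq V^{*}$ is called closed if it is closed under taking subwords (every factor of a word of $L$ is in $L$); it is called redundant if for every $x \in L$ there is an integer $n_x \geq 1$ such that for every $z \in L$, $|z| \geq n_x$ implies $x < z$; it is called almost periodic if it is closed and redundant. A family $\mathcal{F}$ of languages avoids almost periodicity if every almost periodic language in $\mathcal{F}$ is regular. *)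

(* Defs.v *)
From HB Require Import structures.
From mathcomp Require Import all_boot.
From mathcomp Require Import boolp classical_sets functions cardinality.

Set Implicit Arguments.
Unset Strict Implicit.
Unset Printing Implicit Defensive.

Local Open Scope classical_set_scope.

(* A language carries its own alphabet, so that a family of languages may mix
   languages over different finite alphabets. *)
Record language := Language {
  alphabet : finType;
  words :> set (seq alphabet)
}.

(* Not [set language]: the universe of [finType] is above that of [set]. *)
Definition language_family := language -> Prop.

(* "Subword" means contiguous factor, hence [infix] and not [subseq]. *)
Definition SubL (V : eqType) (L : set (seq V)) : set (seq V) :=
  [set x | exists2 z, L z & infix x z].

Definition word_pow (V : Type) (w : seq V) (n : nat) : seq V :=
  flatten (nseq n w).

Definition closed_language (V : eqType) (L : set (seq V)) : Prop :=
  forall x z : seq V, L z -> infix x z -> L x.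

Definition redundant (V : eqType) (L : set (seq V)) : Prop :=
  forall x, L x ->
    exists n : nat, 1 <= n /\ forall z, L z -> n <= size z -> infix x z.

Definition almost_periodic (V : eqType) (L : set (seq V)) : Prop :=
  closed_language L /\ redundant L.

Record dfa (V : finType) := DFA {
  dfa_state : finType;
  dfa_start : dfa_state;
  dfa_final : {set dfa_state};
  dfa_trans : dfa_state -> V -> dfa_state
}.

Definition dfa_accepts (V : finType) (A : dfa V) (w : seq V) : bool :=
  foldl (@dfa_trans V A) (dfa_start A) w \in dfa_final A.

Definition regular (V : finType) (L : set (seq V)) : Prop :=
  exists A : dfa V, L = [set w | dfa_accepts A w].

Definition avoids_almost_periodicity (F : language_family) : Prop :=
  forall L : language, F L -> almost_periodic L -> regular L.

(* Main.v *)
(** If an almost periodic language [L] is infinite, then all powers of some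
    nonempty word [w] lie in [L]. Redundancy puts every word of [L] inside a
    long enough power of [w], so [L] is the set of factors of powers of [w].
    After reading a factor, what may follow depends only on the set of positions
    modulo [size w] where that factor can end, so there are finitely many
    residuals. *)
Require Import Defs.
From mathcomp Require Import all_boot.
From mathcomp Require Import boolp classical_sets functions cardinality.

Local Open Scope classical_set_scope.

Section Regularity.
Variable V : finType.
Implicit Types (L : set (seq V)) (x w : seq V).

(** The Myhill-Nerode argument with residuals indexed by [T]: the indices are the states, and [t] is
    final when [res t] contains the empty word. [res] may repeat a language, so no residuals have to
    be counted or compared. *)
Lemma regular_finite_residuals (T : finType) (res : T -> set (seq V)) :
  (forall t a, exists t', res t' = [set x | res t (a :: x)]) ->
  forall t, regular (res t).
Proof.
move=> res_step t0.
have /choice[step stepE] (p : T * V) :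
    exists t', res t' = [set x | res p.1 (p.2 :: x)].
  exact: res_step.
exists (DFA t0 [set t | `[< res t [::] >]]%SET (fun t a => step (t, a))).
rewrite predeqE => x /=; rewrite /dfa_accepts /=.
elim: x t0 => [|a x IHx] t /=; first by rewrite inE; split=> /asboolP.
by rewrite -(IHx (step (t, a))) stepE.
Qed.

(** Deleting a first letter keeps the bound [N], so all residuals are among the finitely many
    subsets of [N.-bseq V]. *)
Lemma regular_bounded L N : (forall x, L x -> size x <= N) -> regular L.
Proof.
pose res (S : {set N.-bseq V}) : set (seq V) :=
  [set x | exists2 y, y \in S & val y = x].
have resP K : (forall x, K x -> size x <= N) -> exists S, res S = K.
  move=> K_le; exists [set y : N.-bseq V | `[< K y >]]%SET.
  rewrite predeqE => x; split=> [[y]|Kx]; first by rewrite inE => /asboolP + <-.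
  by exists (Bseq (K_le x Kx)) => //; rewrite inE; apply/asboolP.
move=> /resP[S <-]; apply: regular_finite_residuals => {}S a.
by apply: resP => x [y _ yE]; rewrite ltnW // -[_.+1]/(size (a :: x)) -yE size_bseq.
Qed.

Lemma regular_finite L : finite_set L -> regular L.
Proof.
move=> /finite_seqP[s ->]; apply: (@regular_bounded _ (\max_(x <- s) size x)).
by move=> x /= xs; apply: leq_bigmax_seq.
Qed.

Lemma size_word_pow w n : size (word_pow w n) = n * size w.
Proof. by rewrite /word_pow size_flatten /shape map_nseq sumn_nseq mulnC. Qed.

Lemma nth_word_pow d w n k :
  k < n * size w -> nth d (word_pow w n) k = nth d w (k %% size w).
Proof.
elim: n k => [|n IHn] k; first by rewrite mul0n.
rewrite mulSn => lt_k; rewrite /word_pow /= nth_cat; case: ltnP => [k_lt|le_k].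
  by rewrite modn_small.
by rewrite IHn ?ltn_subLR // -[in RHS](subnK le_k) modnDr.
Qed.

(** A factor of a power of [w] reads [w] cyclically, starting from its offset modulo [size w]. The
    letter [d] is only a default for [nth]. *)
Lemma infix_word_powP d w x : w <> [::] ->
  (exists n, infix x (word_pow w n)) <->
  exists i : 'I_(size w),
    x = mkseq (fun j => nth d w ((i + j) %% size w)) (size x).
Proof.
move=> w_nil; have w_gt0 : 0 < size w by case: w w_nil.
split=> [[n /infixP[p [s wnE]]]|[i xE]].
  exists (Ordinal (ltn_pmod (size p) w_gt0)) => /=.
  apply: (@eq_from_nth _ d); rewrite ?size_mkseq // => j lt_j.
  have := size_word_pow w n; rewrite wnE !size_cat => size_wn.
  rewrite nth_mkseq // modnDml -(@nth_word_pow d w n).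
    by rewrite wnE nth_cat ltnNge leq_addr addKn nth_cat lt_j.
  by rewrite -size_wn ltn_add2l ltn_addr.
(* The exponent [i + size x] is generous: as [w] is nonempty, that power is long enough to hold
   [size x] letters from offset [i]. *)
have le_n : i + size x <= (i + size x) * size w by rewrite leq_pmulr.
exists (i + size x).
suff xE' : x = take (size x) (drop i (word_pow w (i + size x))).
  by rewrite {1}xE'; apply: infix_trans (infix_take _ _) (infix_drop _ _).
have size_x : size (take (size x) (drop i (word_pow w (i + size x)))) = size x.
  rewrite size_takel // size_drop size_word_pow leq_subRL //.
  by rewrite (leq_trans _ le_n) ?leq_addr.
apply: (@eq_from_nth _ d) => // j lt_j.
rewrite nth_take // nth_drop nth_word_pow.
  by rewrite [in LHS]xE nth_mkseq.
by rewrite (leq_trans _ le_n) // ltn_add2l.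
Qed.

Lemma regular_infix_word_pow w : w <> [::] ->
  regular [set x | exists n, infix x (word_pow w n)].
Proof.
move=> w_nil; have [d _] : exists d : V, True by case: w w_nil => // d; exists d.
(* [S] collects the offsets in [w] from which the rest of the word may be read; at the start every
   offset is allowed. *)
pose res (S : {set 'I_(size w)}) : set (seq V) := [set x | exists2 i, i \in S &
  x = mkseq (fun j => nth d w ((i + j) %% size w)) (size x)].
have -> : [set x | exists n, infix x (word_pow w n)] = res [set: 'I_(size w)]%SET.
  rewrite predeqE => x; split=> /= [/(infix_word_powP d _ _ w_nil)[i xE]|[i _ xE]].
    by exists i; rewrite ?inE.
  by apply/(infix_word_powP d _ _ w_nil); exists i.
apply: regular_finite_residuals => S a.
(* Reading [a] keeps the offsets that carry [a] and advances each by one, [ordS] wrapping around at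
   the end of [w]. *)
exists [set ordS i | i in S & nth d w i == a]%SET.
have consE (i : 'I_(size w)) x :
    (a :: x = mkseq (fun j => nth d w ((i + j) %% size w)) (size x).+1) <->
    (nth d w i = a /\
     x = mkseq (fun j => nth d w ((ordS i + j) %% size w)) (size x)).
  rewrite /mkseq /= addn0 modn_small // (iotaDl 1 0) -map_comp.
  rewrite (@eq_map _ _ _ (fun j => nth d w ((i.+1 %% size w + j) %% size w))).
    by split=> [[-> xE]|[-> {1}->]].
  by move=> j /=; rewrite modnDml (addSnnS i).
rewrite predeqE => x; split=> [[_ /imsetP[i + ->]]|[i iS /consE[wi xE]]].
  by rewrite inE => /andP[iS /eqP wi] xE; exists i => //; apply/consE.
by exists (ordS i) => //; apply/imsetP; exists i; rewrite // inE iS wi eqxx.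
Qed.

Lemma almost_periodic_word_pow L w :
  almost_periodic L -> w <> [::] -> (forall n, 1 <= n -> SubL L (word_pow w n)) ->
  L = [set x | exists n, infix x (word_pow w n)].
Proof.
move=> [closedL redL] w_nil powL.
have {}powL n : 1 <= n -> L (word_pow w n).
  by move=> /powL[z Lz]; apply: closedL.
rewrite predeqE => x; split=> [/redL[n [n_gt0 inf_x]]|[[|n] inf_x]].
(* The redundancy bound itself serves as exponent, since the [n]-th power of a nonempty word has
   length at least [n]. *)
- exists n; apply: inf_x; first exact: powL.
  by rewrite size_word_pow leq_pmulr //; case: w w_nil {powL}.
(* Exponent 0 lies outside [powL]; its only factor is the empty word, which is also a factor of
   [w]. *)
- apply: (closedL _ (word_pow w 1)); first exact: powL.
  by move: inf_x; rewrite infixs0 => /eqP->; apply: infix0s.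
- by apply: closedL inf_x; apply: powL.
Qed.

End Regularity.

Theorem theorem1 (F : language_family)
  (hF : forall L : language, F L -> infinite_set L ->
     exists w : seq (alphabet L),
       w <> [::] /\ [set word_pow w n | n in [set n : nat | 1 <= n]] `<=` SubL L) :
  avoids_almost_periodicity F.
Proof.
move=> L FL apL; have [/regular_finite//|infL] := pselect (finite_set L).
have [w [w_nil powL]] := hF L FL infL.
rewrite (almost_periodic_word_pow _ _ _ apL w_nil).
  exact: regular_infix_word_pow.
by move=> n n_gt0; apply: powL; exists n.
Qed.
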